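(* Let $\beta_*\in\mathbb{R}$ and $\sigma>0$ ($\sigma$ known), and let $(X_i,Y_i)$, $1\le i\le n$, be i.i.d. copies of $(X,Y)$ with $Y=X\beta_*+\sigma\varepsilon$, where $X,\varepsilon$ are i.i.d. $N(0,1)$. Let $(\widetilde X_i,\widetilde Y_i)$ be the 1-bit dithered quantizations with ranges $[-R,R]$ and $[-L,L]$, and consider the likelihood $$\mathsf L(\beta)=\prod_{i=1}^n\pi(\beta)^{c_i}(1-\pi(\beta))^{1-c_i},\qquad c_i=I(\mathrm{sign}(\widetilde X_i)=\mathrm{sign}(\widetilde Y_i)),$$ where $\pi(\beta)=2\,\mathbf{P}_\beta(\widetilde X_1>0,\widetilde Y_1>0)$ (see context). Suppose that, for $n\ge3$, $L=L_n\ge\sqrt{2(\sigma^2+\beta_*^2)(\log\log n)^{1/2}}$ and $R=R_n=O(\sqrt{\log n})$. Then the associated Fisher information satisfies $$\frac1n\mathbf{E}\left[-\frac{d^2}{d\beta^2}\log\mathsf L(\beta)\Big|_{\beta=\beta_*}\right]=\{\dot\pi(\beta_* )\}^2\left(\frac1{\pi(\beta_* )}+\frac1{1-\pi(\beta_* )}\right)\le\frac{1}{L^2R^2}\,C(\beta_*,\sigma),$$ where $\dot\pi$ is the derivative of $\pi$ and $C(\beta_*,\sigma)$ is a constant depending only on $\beta_*$ and $\sigma$.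
   Context: Quantization: $\widetilde X_i=R\,\mathrm{sign}(X_i+\xi_i)$ and $\widetilde Y_i=L\,\mathrm{sign}(Y_i+\xi_i')$, where $\xi_i\sim\mathrm{Unif}(-R,R)$, $\xi_i'\sim\mathrm{Unif}(-L,L)$ are independent of each other, across $i$, and of the data. (For $|X_i|\le R$ this means that $\widetilde X_i$ equals $R$ with probability $(X_i+R)/(2R)$ and $-R$ otherwise, given $X_i$; similarly for $Y_i$.) $\mathbf{P}_\beta$ denotes probability when the regression parameter is $\beta$ in place of $\beta_*$, i.e. when $(X_1,Y_1)$ is a centered bivariate Gaussian vector with covariance matrix $\begin{pmatrix}1&\beta\\\beta&\beta^2+\sigma^2\end{pmatrix}$, with $R,L$ held fixed as $\beta$ varies. The expectation in the claim is under the true parameter $\beta_*$. *)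

(* Defs.v *)
From HB Require Import structures.
From mathcomp Require Export all_boot all_order all_algebra.
From mathcomp Require Export all_classical all_reals all_analysis.

Set Implicit Arguments.
Unset Strict Implicit.
Unset Printing Implicit Defensive.

Export Order.TTheory GRing.Theory Num.Theory.
Export numFieldNormedType.Exports.

Global Open Scope classical_set_scope.
Global Open Scope ring_scope.

(* [measurableTypeR K] is K with its Borel sigma-algebra, in the form on which
   the library defines [normal_prob] and [uniform_prob]. *)
Definition std_normal (K : realType) : probability (measurableTypeR K) K :=
  normal_prob 0 1.

Lemma posnum_ltNr (K : realType) (r : {posnum K}) : - r%:num < r%:num.
Proof. by rewrite gtrN. Qed.

Definition dither_law (K : realType) (r : {posnum K}) :
    probability (measurableTypeR K) K :=
  uniform_prob (posnum_ltNr r).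

Definition regression_map (K : realType) (beta sigma : K)
    (z : measurableTypeR K * measurableTypeR K) :
    measurableTypeR K * measurableTypeR K :=
  (z.1, z.1 * beta + sigma * z.2).

Lemma measurable_regression_map (K : realType) (beta sigma : K) :
  measurable_fun setT (regression_map beta sigma).
Proof.
apply: measurable_fun_pair => //=.
by apply: measurable_realfun.measurable_funD;
  apply: measurable_realfun.measurable_funM.
Qed.

HB.instance Definition _ (K : realType) (beta sigma : K) :=
  isMeasurableFun.Build _ _ _ _ (regression_map beta sigma)
    (measurable_regression_map beta sigma).

(* Law of (X, Y), Y = X beta + sigma eps, with X, eps i.i.d. N(0,1): for
   0 < sigma this is the centered bivariate Gaussian law with covariance matrix
   [[1, beta], [beta, beta^2 + sigma^2]]. *)
Definition regression_law (K : realType) (beta sigma : K) :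
    probability (measurableTypeR K * measurableTypeR K)%type K :=
  distribution (std_normal K \x std_normal K)%E (regression_map beta sigma).

(* [Num.sg 0 = 0], so the value is 0, rather than +r or -r, on the null event
   x + u = 0. *)
Definition quantize (K : realType) (r : {posnum K}) (x u : K) : K :=
  r%:num * Num.sg (x + u).

(* Joint law of ((X_1, Y_1), (xi_1, xi'_1)) when the regression parameter is
   beta. *)
Definition prob_beta (K : realType) (sigma : K) (r l : {posnum K}) (beta : K) :
    probability ((measurableTypeR K * measurableTypeR K) *
                 (measurableTypeR K * measurableTypeR K))%type K :=
  (regression_law beta sigma \x (dither_law r \x dither_law l))%E.

Definition agree_prob (K : realType) (sigma : K) (r l : {posnum K})
    (beta : K) : K :=
  2 * fine (prob_beta sigma r l beta
    [set w | 0 < quantize r w.1.1 w.2.1 /\ 0 < quantize l w.1.2 w.2.2]).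

Definition likelihood (K : realType) (n : nat) (sigma : K) (r l : {posnum K})
    (c : 'I_n -> bool) (beta : K) : K :=
  \prod_(i < n) (agree_prob sigma r l beta ^+ c i *
                 (1 - agree_prob sigma r l beta) ^+ (1 - c i)%N).

(* Mutual independence of the finite family (X_i, Y_i), xi_i, xi'_i (i < n):
   the product rule for subfamilies is obtained by taking some of the sets
   equal to setT. *)
Definition indep_sample d (T : measurableType d) (K : realType)
    (P : probability T K) (n : nat) (X Y xi xi' : 'I_n -> {RV P >-> K}) :=
  forall (A : 'I_n -> set (K * K)) (B B' : 'I_n -> set K),
    (forall i, measurable (A i)) -> (forall i, measurable (B i)) ->
    (forall i, measurable (B' i)) ->
    P [set w | forall i, [/\ A i (X i w, Y i w), B i (xi i w) & B' i (xi' i w)]]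
    = (\prod_(i < n) (P [set w | A i (X i w, Y i w)] *
                      P [set w | B i (xi i w)] *
                      P [set w | B' i (xi' i w)]))%E.

Record dithered_sample d (T : measurableType d) (K : realType)
    (P : probability T K) (n : nat) (beta sigma : K) (r l : {posnum K})
    (X Y xi xi' : 'I_n -> {RV P >-> K}) : Prop := DitheredSample {
  data_law : forall i A, measurable A ->
    P [set w | A (X i w, Y i w)] = regression_law beta sigma A ;
  xi_law : forall i B, measurable B -> P (xi i @^-1` B) = dither_law r B ;
  xi'_law : forall i B, measurable B -> P (xi' i @^-1` B) = dither_law l B ;
  sample_indep : indep_sample X Y xi xi' }.

(* c_i = I(sign of the quantized X_i = sign of the quantized Y_i). *)
Definition sign_agree d (T : measurableType d) (K : realType)
    (P : probability T K) (n : nat) (r l : {posnum K})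
    (X Y xi xi' : 'I_n -> {RV P >-> K}) (w : T) (i : 'I_n) : bool :=
  Num.sg (quantize r (X i w) (xi i w)) == Num.sg (quantize l (Y i w) (xi' i w)).

(* Main.v *)
Require Import Defs.
From mathcomp Require Import measurable_realfun ring lra.

Set Implicit Arguments.
Unset Strict Implicit.
Unset Printing Implicit Defensive.

(* Integrating the noise variable eps out first, the probability of agreement is
   p(b) = 2 E[1(X + xi > 0) Q(-(X b + xi') / sigma)] with Q the upper tail of
   N(0,1), which is smooth in b; the expectation can be differentiated twice
   under the integral sign, with the dominating functions c |X| and c X^2.  In
   p'(b) = 2 E[1(X + xi > 0) X k(X, xi')], with k the N(-X b, sigma^2) density
   at xi', the invariance of the law under (X, xi, xi') -> -(X, xi, xi') and
   xi -> -xi cancels the integrand outside the event |xi| <= |X|, of conditional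
   probability at most |X| / R, while k integrates to at most 1 / (2 L) in xi'.
   Hence |p'| <= E[X^2] / (2 L R).  Since L is bounded below by
   l0 = sqrt(2 (sigma^2 + bstar^2) (ln ln 3)^(1/2)) > 0, p stays away from 0
   and 1: all four sign patterns have probability at least some
   delta(bstar, sigma, l0) > 0. *)

(** * Invariance under sign changes *)

(** [mu] is an unbundled set function, so that the notion also covers a law given directly as the
    integral of a density. *)
Definition measure_preserving d (T : measurableType d) (K : realType)
    (mu : set T -> \bar K) (f : T -> T) :=
  forall A, measurable A -> mu (f @^-1` A) = mu A.

Section measure_preserving.
Local Open Scope ereal_scope.
Context (K : realType).

(** The image of the product measure has the same values on rectangles as the product measure, and
    these values determine it. *)
Lemma measure_preserving_prod d1 d2 (T1 : measurableType d1)
    (T2 : measurableType d2) (m1 : probability T1 K) (m2 : probability T2 K)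
    (f1 : T1 -> T1) (f2 : T2 -> T2) :
  measurable_fun setT f1 -> measurable_fun setT f2 ->
  measure_preserving m1 f1 -> measure_preserving m2 f2 ->
  measure_preserving (m1 \x m2) (fun z => (f1 z.1, f2 z.2)).
Proof.
move=> mf1 mf2 p1 p2 A mA.
have mf : measurable_fun setT (fun z : T1 * T2 => (f1 z.1, f2 z.2)).
  by apply: measurable_fun_pair; apply: measurableT_comp.
pose F := mfun_Sub (mem_set mf).
transitivity (pushforward (m1 \x m2) F A); first by [].
apply/esym/product_measure_unique => // B C mB mC; rewrite /pushforward/=.
transitivity ((m1 \x m2) ((f1 @^-1` B) `*` (f2 @^-1` C))); first by [].
rewrite product_measure1E; first by congr (_ * _); [exact: p1|exact: p2].
- by rewrite -[X in measurable X]setTI; exact: mf1.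
- by rewrite -[X in measurable X]setTI; exact: mf2.
Qed.

Lemma ge0_integral_preserving d (T : measurableType d)
    (mu : {measure set T -> \bar K}) (f : T -> T) (h : T -> \bar K) :
  measurable_fun setT f -> measure_preserving mu f ->
  measurable_fun setT h -> (forall x, 0 <= h x) ->
  \int[mu]_x h (f x) = \int[mu]_x h x.
Proof.
move=> mf pf mh h0; have := ge0_integral_pushforward mf mu measurableT mh.
rewrite preimage_setT => <-; last by move=> x _; exact: h0.
by apply: eq_measure_integral => // A mA _; rewrite /= /pushforward pf.
Qed.

Lemma Rintegral_preserving d (T : measurableType d)
    (mu : {measure set T -> \bar K}) (f : T -> T) (h : T -> K) :
  measurable_fun setT f -> measure_preserving mu f ->
  mu.-integrable setT (EFin \o h) ->
  (\int[mu]_x h (f x) = \int[mu]_x h x)%R.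
Proof.
move=> mf pf ih; have mh := measurable_int _ ih.
rewrite /Rintegral; congr fine.
have := @integral_pushforward _ _ _ _ _ _ mf mu setT (EFin \o h) mh.
rewrite preimage_setT => <- //; last first.
  (* The pushforward formula for signed [h] asks that [h \o f] be integrable; the nonnegative case
     applied to [|h|] shows it. *)
  apply/integrableP; split; first exact: (measurableT_comp mh mf).
  have /integrableP[_] := ih.
  rewrite -(@ge0_integral_preserving _ _ mu f (fun x => `|(h x)%:E|) mf pf) //.
  exact: (measurableT_comp _ mh).
by apply: eq_measure_integral => // A mA _; rewrite /= /pushforward pf.
Qed.

(** Lebesgue measure is invariant under negation and the density is even. Both the normal and the
    dither laws have this form. *)
Lemma measure_preserving_oppr_density (g : K -> K) :
  measurable_fun setT g -> (forall x, (0 <= g x)%R) ->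
  (forall x, g (- x) = g x)%R ->
  @measure_preserving _ (measurableTypeR K) _
    (fun A => \int[lebesgue_measure]_(x in A) (g x)%:E) -%R.
Proof.
move=> mg g0 gN A mA.
have mN : measurable_fun setT (-%R : measurableTypeR K -> measurableTypeR K).
  exact: oppr_measurable.
transitivity (\int[pushforward lebesgue_measure
    (-%R : measurableTypeR K -> measurableTypeR K)]_(x in A) (g x)%:E).
  rewrite ge0_integral_pushforward //.
  - by apply: eq_integral => x _ /=; rewrite gN.
  - by apply/measurable_EFinP; exact: measurable_funTS.
  - by move=> x _; rewrite lee_fin.
by apply: eq_measure_integral => // B mB _; exact: lebesgue_measureN.
Qed.

Lemma normal_pdf_opp (x : K) : (normal_pdf 0 1 (- x) = normal_pdf 0 1 x)%R.
Proof. by rewrite !normal_pdfE ?oner_neq0// /normal_fun !subr0 sqrrN. Qed.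

Lemma std_normal_oppr : measure_preserving (std_normal K) -%R.
Proof.
move=> A mA; apply: measure_preserving_oppr_density => //.
- exact: measurable_normal_pdf.
- by move=> x; exact: normal_pdf_ge0.
- exact: normal_pdf_opp.
Qed.

Lemma dither_oppr (r : {posnum K}) : measure_preserving (dither_law r) -%R.
Proof.
move=> A mA; apply: measure_preserving_oppr_density => //.
- exact: measurable_uniform_pdf.
- by move=> x; apply: uniform_pdf_ge0; exact: posnum_ltNr.
- by move=> x; rewrite /uniform_pdf lerNl opprK (lerNl x) andbC.
Qed.

Lemma measure_preserving_id d (T : measurableType d) (mu : set T -> \bar K) :
  measure_preserving mu id.
Proof. by []. Qed.

End measure_preserving.

(** * The standard normal law *)

Section std_normal.
Context (K : realType).
Local Notation lam := (@lebesgue_measure K).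
Local Notation phi := (@normal_pdf K 0 1).

(** The Radon-Nikodym derivative of the normal law equals [phi] almost everywhere, since both have
    the same integral over every measurable set. *)
Lemma ge0_integral_std_normal (f : K -> \bar K) :
  measurable_fun setT f -> (forall x, 0 <= f x)%E ->
  (\int[std_normal K]_x f x = \int[lam]_x (f x * (phi x)%:E))%E.
Proof.
move=> mf f0; have dom := @normal_prob_dominates K 0 1.
rewrite -(Radon_Nikodym_SigmaFinite.change_of_variables dom) //.
have mphi : measurable_fun setT (EFin \o phi).
  by apply/measurable_EFinP; exact: measurable_normal_pdf.
apply: ae_eq_integral => //.
- apply: emeasurable_funM => //.
  exact: measurable_int (Radon_Nikodym_SigmaFinite.f_integrable dom).
- exact: emeasurable_funM.
apply: ae_eqe_mul2l.
apply: integral_ae_eq => //.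
- exact: Radon_Nikodym_SigmaFinite.f_integrable.
- by move=> A _ mA; rewrite -(Radon_Nikodym_SigmaFinite.f_integral dom).
Qed.

Lemma normal_pdf01E (x : K) :
  phi x = normal_peak 1 * expR (- (x ^+ 2 / 2)).
Proof.
by rewrite normal_pdfE ?oner_neq0// /normal_fun subr0 expr1n mulNr.
Qed.

(* Since x ^+ 2 / 4 <= expR (x ^+ 2 / 4), the factor x ^+ 2 can be traded for a
   larger variance. *)
Lemma sqr_normal_pdf_le (x : K) :
  x ^+ 2 * phi x <=
  4 * normal_peak 1 / normal_peak (Num.sqrt 2) * normal_pdf 0 (Num.sqrt 2) x.
Proof.
have s2 : Num.sqrt 2 != 0 :> K by rewrite gt_eqF// sqrtr_gt0.
rewrite normal_pdf01E [in leRHS]normal_pdfE// /normal_fun subr0 sqr_sqrtr//.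
rewrite mulrA mulfVK ?gt_eqF ?normal_peak_gt0//.
have -> : - x ^+ 2 / (2 *+ 2) = x ^+ 2 / 4 + - (x ^+ 2 / 2) by field.
rewrite expRD [leRHS]mulrA [leLHS]mulrA ler_wpM2r ?expR_ge0//.
rewrite [leRHS]mulrAC ler_wpM2r ?normal_peak_ge0//.
have := expR_ge1Dx (x ^+ 2 / 4); lra.
Qed.

(** By [sqr_normal_pdf_le] the integrand is dominated by a multiple of the N(0,2) density, which
    integrates to 1. *)
Lemma std_normal_sqr_lty :
  (\int[std_normal K]_x (x ^+ 2)%:E < +oo)%E.
Proof.
rewrite ge0_integral_std_normal.
- apply: (@le_lt_trans _ _ (\int[lam]_x
    ((4 * normal_peak 1 / normal_peak (Num.sqrt 2))%:E *
     (normal_pdf 0 (Num.sqrt 2) x)%:E))%E).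
    apply: ge0_le_integral => //.
    + by move=> x _; rewrite -EFinM lee_fin mulr_ge0 ?sqr_ge0 ?normal_pdf_ge0.
    + apply/measurable_EFinP/measurable_funM => //.
      exact: measurable_normal_pdf.
    + apply/measurable_EFinP/measurable_funM => //.
      exact: measurable_normal_pdf.
    + by move=> x _; rewrite -EFinM lee_fin sqr_normal_pdf_le.
  rewrite integralZl//; last exact: integrable_normal_pdf.
  by rewrite integral_normal_pdf mule1 ltry.
- by apply/measurable_EFinP; exact: measurable_funX.
- by move=> x; rewrite lee_fin sqr_ge0.
Qed.

Lemma integrable_std_normal_sqr :
  (std_normal K).-integrable setT (fun x => (x ^+ 2)%:E).
Proof.
apply/integrableP; split; first exact/measurable_EFinP/measurable_funX.
under eq_integral do rewrite gee0_abs ?lee_fin ?sqr_ge0//.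
exact: std_normal_sqr_lty.
Qed.

Lemma integrable_std_normal_norm :
  (std_normal K).-integrable setT (fun x => `|x|%:E).
Proof.
apply: (@le_integrable _ _ _ (std_normal K) _ measurableT _
  (fun x : measurableTypeR K => (1 + x ^+ 2)%:E)).
- by apply/measurable_EFinP; exact: normr_measurable.
- move=> x _; rewrite lee_fin normr_id ger0_norm ?addr_ge0 ?sqr_ge0//.
  by rewrite -(real_normK (num_real x)); have := sqr_ge0 (`|x| - 1); nra.
- apply: (@integrableD _ _ _ (std_normal K) _ measurableT (EFin \o cst 1)
    (fun x : measurableTypeR K => (x ^+ 2)%:E)) => //.
  + exact: finite_measure_integrable_cst.
  + exact: integrable_std_normal_sqr.
Qed.

(** From |x| <= 1 + x^2/2 <= exp(x^2/2). The left side is |phi'(x)|, so this controls the second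
    derivative of the kernel in [b]. *)
Lemma normr_normal_pdf_le (x : K) : `|x| * phi x <= normal_peak 1.
Proof.
rewrite normal_pdf01E mulrCA ler_piMr ?normal_peak_ge0//.
rewrite expRN -[_^-1]mul1r mulrA mulr1 ler_pdivrMr ?expR_gt0// mul1r.
have := expR_ge1Dx (x ^+ 2 / 2).
rewrite -(real_normK (num_real x)).
have := sqr_ge0 (`|x| - 1); nra.
Qed.

Definition std_normal_tail (t : K) : K := fine (std_normal K [set x | t < x]).

Lemma std_normal_tail_ge0 t : 0 <= std_normal_tail t.
Proof. exact: fine_ge0. Qed.

Let measurable_itvoy (t : K) : measurable [set x : measurableTypeR K | t < x].
Proof. by rewrite -set_itvoy; exact: measurable_itv. Qed.

Lemma std_normal_tail_le1 t : std_normal_tail t <= 1.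
Proof.
by rewrite -lee_fin fineK ?fin_num_measure//; exact: probability_le1.
Qed.

(** The tail is 1 minus the distribution function, and the fundamental theorem of calculus applies
    because [phi] is continuous. *)
Lemma is_derive_std_normal_tail (t : K) :
  is_derive t 1 std_normal_tail (- phi t).
Proof.
have -> : std_normal_tail = fun x => 1 - \int[lam]_(y in `]-oo, x]) phi y.
  apply/funext => x; rewrite /std_normal_tail.
  have -> : [set y | x < y] = ~` [set` `]-oo, x]].
    by apply/seteqP; split=> y /=; rewrite in_itv/= -?ltNge ?ltNge => /negP.
  rewrite probability_setC//= fineB ?fin_num_measure//.
have [||||/= df dfE] := @continuous_FTC1 K phi -oo%O t (t + 1).
- by rewrite ltrDl.
- apply: (integrableS _ _ (@subsetT _ _)) => //.
  exact: integrable_normal_pdf.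
- by rewrite ltNyr.
- by apply: continuous_normal_pdf; rewrite oner_neq0.
have dF := DeriveDef df (esym (derive1E _ _)).
rewrite -[fun x : K => _]/(cst 1 - (fun x : K => \int[lam]_(t in `]-oo, x]) phi t)).
by apply: is_derive_eq; rewrite dfE sub0r.
Qed.

Lemma is_derive_normal_pdf (t : K) : is_derive t 1 phi (- (t * phi t)).
Proof.
have -> : phi = fun x => normal_peak 1 * expR (- (2^-1 * x ^+ 2)).
  by apply/funext => x; rewrite normal_pdf01E (mulrC 2^-1).
apply: is_derive_eq.
by rewrite /GRing.scale/= mulr1; field.
Qed.

Lemma measurable_std_normal_tail : measurable_fun setT std_normal_tail.
Proof.
apply: continuous_measurable_fun => t; apply: differentiable_continuous.
apply/derivable1_diffP; apply: ex_derive; exact: is_derive_std_normal_tail.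
Qed.

End std_normal.

(** * Differentiability of the probability of agreement *)

Lemma measurable_set_ltr d (T : measurableType d) (K : realType) (f g : T -> K) :
  measurable_fun setT f -> measurable_fun setT g ->
  measurable [set x | f x < g x].
Proof.
move=> mf mg; have := measurable_fun_ltr mf mg measurableT (Y := [set true]).
by rewrite setTI; apply.
Qed.

Lemma measure_integral_indic d (T : measurableType d) (K : realType)
    (mu : {measure set T -> \bar K}) A :
  measurable A -> mu A = (\int[mu]_x (\1_A x)%:E)%E.
Proof. by move=> mA; rewrite integral_indic// setIT. Qed.

Section agree_prob.
Context (K : realType) (sigma : K) (sigma_gt0 : 0 < sigma) (r l : {posnum K}).
Local Notation RT := (measurableTypeR K).

(** Sign patterns are coded by factors [s], [t] equal to 1 or -1, so that one definition covers all
    four. *)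
Definition quadrant (s t : K) : set ((RT * RT) * (RT * RT)) :=
  [set w | 0 < s * (w.1.1 + w.2.1) /\ 0 < t * (w.1.2 + w.2.2)].

Lemma measurable_quadrant s t : measurable (quadrant s t).
Proof.
apply: (@measurableI _ _
  [set w : (RT * RT) * (RT * RT) | 0 < s * (w.1.1 + w.2.1)]
  [set w | 0 < t * (w.1.2 + w.2.2)]); apply: measurable_set_ltr => //;
  by apply: measurable_funM => //; apply: measurable_funD;
    apply: measurableT_comp.
Qed.

Lemma quadrant_disjoint : quadrant 1 1 `&` quadrant (- 1) (- 1) = set0.
Proof.
rewrite -subset0 => w [] /=; rewrite /quadrant/= !mul1r !mulN1r.
by move=> [? _] [? _]; lra.
Qed.

Lemma agree_prob_quadrant b :
  agree_prob sigma r l b = 2 * fine (prob_beta sigma r l b (quadrant 1 1)).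
Proof.
rewrite /agree_prob; congr (2 * fine (_ _)).
by apply/seteqP; split=> w; rewrite /quadrant/= /quantize !mul1r
  !pmulr_rgt0// !sgr_gt0.
Qed.

(** The regression map is linear, so negating (X, Y) amounts to negating (X, eps); the normal and
    dither laws are symmetric. *)
Lemma prob_beta_oppr b :
  measure_preserving (prob_beta sigma r l b)
    (fun w => ((- w.1.1, - w.1.2), (- w.2.1, - w.2.2))).
Proof.
have mN : measurable_fun setT (-%R : RT -> RT) by exact: oppr_measurable.
apply: (@measure_preserving_prod _ _ _ _ _ (regression_law b sigma)
  (dither_law r \x dither_law l)%E
  (fun z => (- z.1, - z.2)) (fun z => (- z.1, - z.2))).
- by apply: measurable_fun_pair; apply: measurableT_comp.
- by apply: measurable_fun_pair; apply: measurableT_comp.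
- move=> A mA; rewrite /regression_law /distribution /pushforward/=.
  rewrite -[RHS](measure_preserving_prod mN mN
    (@std_normal_oppr K) (@std_normal_oppr K)); last first.
    by rewrite -[X in measurable X]setTI; exact: measurable_regression_map.
  congr (_ _); apply/seteqP; split=> -[x e]; rewrite /regression_map/=;
    by rewrite mulrN mulNr -opprD.
- exact: (measure_preserving_prod mN mN (@dither_oppr K r) (@dither_oppr K l)).
Qed.

Lemma prob_beta_quadrantNN b :
  prob_beta sigma r l b (quadrant (- 1) (- 1)) =
  prob_beta sigma r l b (quadrant 1 1).
Proof.
rewrite -[RHS](prob_beta_oppr b (measurable_quadrant 1 1)); congr (_ _).
apply/seteqP; split=> w; rewrite /quadrant/= !mulN1r !mul1r !opprD//.
Qed.

(** The law of (X, (xi, xi')), the variables left once eps is integrated out. *)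
Definition quantized_law : probability (RT * (RT * RT))%type K :=
  (std_normal K \x (dither_law r \x dither_law l))%E.

(* The conditional probability that 0 < X + xi and 0 < Y + xi', given
   z = (X, (xi, xi')). *)
Definition agree_kernel (b : K) (z : RT * (RT * RT)) : K :=
  (0 < z.1 + z.2.1)%R%:R * std_normal_tail (- ((z.1 * b + z.2.2) / sigma)).

Lemma measurable_sign_positive :
  measurable_fun setT (fun z : RT * (RT * RT) => (0 < z.1 + z.2.1)%R%:R : K).
Proof.
rewrite (_ : (fun z => _) = \1_[set z | 0 < z.1 + z.2.1]); last first.
  by apply/funext => z; rewrite indicE mem_setE.
apply: measurable_indic; apply: measurable_set_ltr => //.
by apply: measurable_funD => //; apply: measurableT_comp.
Qed.

Lemma measurable_agree_kernel b : measurable_fun setT (agree_kernel b).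
Proof.
apply: measurable_funM; first exact: measurable_sign_positive.
apply: measurableT_comp; first exact: measurable_std_normal_tail.
apply: measurableT_comp => //; apply: measurable_funM => //.
apply: measurable_funD; first exact: measurable_funM.
exact: measurableT_comp.
Qed.

(** Tonelli, with the dithers outermost and eps innermost: for fixed x and v the condition 0 < x b +
    sigma e + v reads e > -(x b + v) / sigma, whose probability is the normal tail. *)
Lemma agree_probE b :
  agree_prob sigma r l b = 2 * \int[quantized_law]_z agree_kernel b z.
Proof.
rewrite agree_prob_quadrant; congr (2 * fine _).
have mQ := measurable_quadrant 1 1.
have mind : measurable_fun setT (fun w => (\1_(quadrant 1 1) w)%:E : \bar K).
  exact/measurable_EFinP/measurable_indic.
have ind_ge0 w : (0 <= (\1_(quadrant 1 1) w)%:E :> \bar K)%E by rewrite lee_fin.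
transitivity (\int[prob_beta sigma r l b]_w (\1_(quadrant 1 1) w)%:E)%E.
  exact: measure_integral_indic.
rewrite [LHS]fubini_tonelli2//.
have mk : measurable_fun setT (fun z => (agree_kernel b z)%:E).
  by apply/measurable_EFinP; exact: measurable_agree_kernel.
have k_ge0 z : (0 <= (agree_kernel b z)%:E)%E.
  by rewrite lee_fin mulr_ge0// std_normal_tail_ge0.
rewrite [RHS]fubini_tonelli2//.
apply: eq_integral => w _; rewrite /fubini_G.
have mindw : measurable_fun setT (fun z => (\1_(quadrant 1 1) (z, w))%:E : \bar K).
  exact: (measurableT_comp mind (pair2_measurable w)).
rewrite [LHS]ge0_integral_distribution//.
have mindwr : measurable_fun setT
    (fun z => (\1_(quadrant 1 1) (regression_map b sigma z, w))%:E : \bar K).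
  exact: (measurableT_comp mindw (measurable_regression_map b sigma)).
rewrite fubini_tonelli1; [|exact: mindwr|by move=> z; exact: ind_ge0].
apply: eq_integral => x _; rewrite /fubini_F/=.
transitivity (\int[std_normal K]_e (\1_[set e | 0 < x + w.1 /\
    - ((x * b + w.2) / sigma) < e] e)%:E)%E.
  apply: eq_integral => e _; rewrite !indicE; congr ((nat_of_bool _)%:R%:E).
  apply/idP/idP; rewrite !inE /quadrant/= !mul1r => -[-> h]; split => //.
    by rewrite -mulNr ltr_pdivrMr//; lra.
  by move: h; rewrite -mulNr ltr_pdivrMr//; lra.
rewrite /agree_kernel/= integral_indic//; last first.
  have [h|h] := boolP (0 < x + w.1).
    rewrite [X in measurable X](_ : _ = [set` `]- ((x * b + w.2) / sigma), +oo[])//.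
    by rewrite set_itvoy; apply/seteqP; split=> e //= -[].
  rewrite [X in measurable X](_ : _ = set0)//.
  by rewrite -subset0 => e [].
rewrite setIT; have [h|h] := boolP (0 < x + w.1).
  rewrite mul1r fineK; last first.
    by apply: fin_num_measure; rewrite -set_itvoy; exact: measurable_itv.
  by congr (std_normal K _); apply/seteqP; split=> e //= -[].
rewrite mul0r; set S := [set e | _].
have -> : S = set0 by rewrite -subset0 => e [].
by rewrite measure0.
Qed.

End agree_prob.

(** * Differentiation under the integral sign *)

Lemma is_derive_under_integral (K : realType) d (Y : measurableType d)
    (mu : {measure set Y -> \bar K}) (f df : K -> Y -> K) (G : Y -> K) (a : K) :
  (forall x, mu.-integrable setT (EFin \o f x)) ->
  (forall (x : K) y, is_derive x 1 (f ^~ y) (df x y)) ->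
  mu.-integrable setT (EFin \o G) ->
  (forall x y, `|df x y| <= G y) ->
  is_derive a 1 (fun x => \int[mu]_y f x y) (\int[mu]_y df a y).
Proof.
move=> intf fdf intG Gdf.
have dE x y : partial1of2 f x y = df x y.
  by rewrite partial1of2E; apply: (@derive_val _ _ _ _ _ _ _ (fdf x y)).
(* The rule is local in [x]; the bound [G] holds for all [x], so any open interval around [a]
   serves. *)
have aI : `]a - 1, a + 1[%classic a by rewrite /= in_itv/=; apply/andP; split; lra.
have intf' x : `]a - 1, a + 1[%classic x -> mu.-integrable setT (EFin \o f x) by [].
have df' x y : `]a - 1, a + 1[%classic x -> [set: Y] y -> derivable (f ^~ y) x 1.
  by move=> _ _; apply: ex_derive; exact: fdf.
have G0 y : 0 <= G y by rewrite (le_trans _ (Gdf a y)).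
have Gub x y : `]a - 1, a + 1[%classic x -> [set: Y] y -> `|partial1of2 f x y| <= G y.
  by rewrite dE.
have D := derivable_under_integral measurableT aI intf' df' G0 intG Gub.
apply: DeriveDef; first exact: D.
rewrite -derive1E (differentiation_under_integral measurableT aI intf' df' G0 intG Gub).
by apply: eq_Rintegral => y _; rewrite dE.
Qed.

Lemma integrable_fst (K : realType) d1 d2 (T1 : measurableType d1)
    (T2 : measurableType d2) (m1 : probability T1 K) (m2 : probability T2 K)
    (g : T1 -> \bar K) :
  m1.-integrable setT g -> (m1 \x m2)%E.-integrable setT (fun z => g z.1).
Proof.
move=> /integrableP[mg ig].
have mg1 : measurable_fun setT (fun z : T1 * T2 => g z.1).
  exact: (measurableT_comp mg).
apply/integrable12ltyP => //=; apply: le_lt_trans ig.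
rewrite le_eqVlt; apply/orP; left; apply/eqP.
apply: eq_integral => x _; rewrite integral_cst//= -[RHS]mule1.
by congr (_ * _)%E; exact: probability_setT.
Qed.

Section derivatives.
Context (K : realType) (sigma : K) (sigma_gt0 : 0 < sigma) (r l : {posnum K}).
Local Notation RT := (measurableTypeR K).
Local Notation mu := (quantized_law r l).
Local Notation phi := (@normal_pdf K 0 1).

(** The derivative of [agree_kernel] in [b]: the minus sign of Q' = -phi cancels that of the
    argument, and [phi] is even. *)
Definition agree_kernel1 (b : K) (z : RT * (RT * RT)) : K :=
  (0 < z.1 + z.2.1)%R%:R * (z.1 / sigma * phi ((z.1 * b + z.2.2) / sigma)).

Definition agree_kernel2 (b : K) (z : RT * (RT * RT)) : K :=
  (0 < z.1 + z.2.1)%R%:R * (z.1 / sigma * (z.1 / sigma *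
    - ((z.1 * b + z.2.2) / sigma * phi ((z.1 * b + z.2.2) / sigma)))).

Lemma is_derive_agree_kernel z (b : K) :
  is_derive b 1 (agree_kernel sigma ^~ z) (agree_kernel1 b z).
Proof.
have h := @is_derive_std_normal_tail K.
rewrite /agree_kernel; apply: is_derive_eq.
by rewrite /agree_kernel1 /GRing.scale/= normal_pdf_opp; ring.
Qed.

Lemma is_derive_agree_kernel1 z (b : K) :
  is_derive b 1 (agree_kernel1 ^~ z) (agree_kernel2 b z).
Proof.
have h := @is_derive_normal_pdf K.
rewrite /agree_kernel1; apply: is_derive_eq.
by rewrite /agree_kernel2 /GRing.scale/=; ring.
Qed.

Let ler_norm_indM (c : bool) (x : K) : `|c%:R * x| <= `|x|.
Proof. by case: c; rewrite ?mul1r// mul0r normr0. Qed.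

(** [phi] is at most its peak. The bound does not involve [b], so it can serve as a dominating
    function. *)
Lemma agree_kernel1_ub b z :
  `|agree_kernel1 b z| <= normal_peak 1 / sigma * `|z.1|.
Proof.
apply: le_trans (ler_norm_indM _ _) _.
have -> : normal_peak 1 / sigma * `|z.1| = `|z.1 / sigma| * normal_peak 1.
  by rewrite normrM normfV (gtr0_norm sigma_gt0); ring.
rewrite normrM (ger0_norm (normal_pdf_ge0 _ _ _)) ler_wpM2l//.
by apply: normal_pdf_ub; rewrite oner_neq0.
Qed.

(** Each differentiation contributes a factor X / sigma, and |t| phi(t) is bounded by
    [normr_normal_pdf_le]. *)
Lemma agree_kernel2_ub b z :
  `|agree_kernel2 b z| <= normal_peak 1 / sigma ^+ 2 * z.1 ^+ 2.
Proof.
apply: le_trans (ler_norm_indM _ _) _.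
set t := (_ + _) / sigma; rewrite mulrA -expr2 normrM normrN.
have -> : normal_peak 1 / sigma ^+ 2 * z.1 ^+ 2 =
    `|(z.1 / sigma) ^+ 2| * normal_peak 1.
  by rewrite ger0_norm ?sqr_ge0// expr_div_n; ring.
by rewrite ler_wpM2l// normrM (ger0_norm (normal_pdf_ge0 _ _ _)) normr_normal_pdf_le.
Qed.

Lemma measurable_agree_kernel1 b : measurable_fun setT (agree_kernel1 b).
Proof.
apply: measurable_funM; first exact: measurable_sign_positive.
apply: measurable_funM; first exact: measurable_funM.
apply: measurableT_comp; first exact: measurable_normal_pdf.
apply: measurable_funM => //.
apply: measurable_funD; first exact: measurable_funM.
exact: measurableT_comp.
Qed.

Lemma integrable_agree_kernel b : mu.-integrable setT (EFin \o agree_kernel sigma b).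
Proof.
apply: (@le_integrable _ _ _ mu _ measurableT _ (EFin \o cst 1)).
- by apply/measurable_EFinP; exact: measurable_agree_kernel.
- move=> z _; rewrite lee_fin normr1; apply: le_trans (ler_norm_indM _ _) _.
  by rewrite ger0_norm ?std_normal_tail_ge0// std_normal_tail_le1.
- exact: finite_measure_integrable_cst.
Qed.

Lemma integrable_norm_fst c : mu.-integrable setT (fun z => (c * `|z.1|)%:E).
Proof.
exact: (integrableZl measurableT c (integrable_fst _ (@integrable_std_normal_norm K))).
Qed.

Lemma integrable_sqr_fst c : mu.-integrable setT (fun z => (c * z.1 ^+ 2)%:E).
Proof.
exact: (integrableZl measurableT c (integrable_fst _ (@integrable_std_normal_sqr K))).
Qed.

Lemma integrable_agree_kernel1 b : mu.-integrable setT (EFin \o agree_kernel1 b).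
Proof.
apply: (@le_integrable _ _ _ mu _ measurableT _
  (fun z => (normal_peak 1 / sigma * `|z.1|)%:E)).
- by apply/measurable_EFinP; exact: measurable_agree_kernel1.
- move=> z _; rewrite lee_fin; apply: le_trans (agree_kernel1_ub b z) _.
  exact: ler_norm.
- exact: integrable_norm_fst.
Qed.

Lemma is_derive_agree_prob (b : K) :
  is_derive b 1 (agree_prob sigma r l) (2 * \int[mu]_z agree_kernel1 b z).
Proof.
have -> : agree_prob sigma r l = 2 *: (fun b => \int[mu]_z agree_kernel sigma b z).
  by apply/funext => x; exact: agree_probE.
apply: is_deriveZ.
apply: (is_derive_under_integral _ integrable_agree_kernel) => //.
- by move=> x y; exact: is_derive_agree_kernel.
- exact: (integrable_norm_fst (normal_peak 1 / sigma)).
- exact: agree_kernel1_ub.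
Qed.

Lemma derivable_agree_prob b : derivable (agree_prob sigma r l) b 1.
Proof. by apply: ex_derive; exact: is_derive_agree_prob. Qed.

Lemma derive1_agree_prob :
  (agree_prob sigma r l)^`()%classic = fun b => 2 * \int[mu]_z agree_kernel1 b z.
Proof.
apply/funext => b; rewrite derive1E.
by apply: derive_val; exact: is_derive_agree_prob.
Qed.

Lemma derivable_derive1_agree_prob b :
  derivable (agree_prob sigma r l)^`()%classic b 1.
Proof.
rewrite derive1_agree_prob.
apply: (@derivableZ _ _ _ (fun b => \int[mu]_z agree_kernel1 b z) 2).
apply: ex_derive; apply: (is_derive_under_integral _ integrable_agree_kernel1) => //.
- by move=> x y; exact: is_derive_agree_kernel1.
- exact: (integrable_sqr_fst (normal_peak 1 / sigma ^+ 2)).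
- exact: agree_kernel2_ub.
Qed.

End derivatives.

(** * Bounds on the probability of agreement and its derivative *)

Lemma RintegralD4 d (T : measurableType d) (K : realType)
    (mu : {measure set T -> \bar K}) (f1 f2 f3 f4 : T -> K) :
  mu.-integrable setT (EFin \o f1) -> mu.-integrable setT (EFin \o f2) ->
  mu.-integrable setT (EFin \o f3) -> mu.-integrable setT (EFin \o f4) ->
  \int[mu]_x (f1 x + f2 x + (f3 x + f4 x)) =
  \int[mu]_x f1 x + \int[mu]_x f2 x + (\int[mu]_x f3 x + \int[mu]_x f4 x).
Proof.
move=> i1 i2 i3 i4; rewrite RintegralD ?RintegralD//.
- exact: (integrableD measurableT i1 i2).
- exact: (integrableD measurableT i3 i4).
Qed.

(** The right side stays in [\bar K], ready for Tonelli. *)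
Lemma norm_Rintegral_le d (T : measurableType d) (K : realType)
    (mu : {measure set T -> \bar K}) (c : K) (f g : T -> K) :
  0 < c -> mu.-integrable setT (EFin \o f) -> measurable_fun setT g ->
  (forall x, `|f x| <= c * g x) ->
  (`|\int[mu]_x f x|%:E <= c%:E * \int[mu]_x (g x)%:E)%E.
Proof.
move=> c0 intf mg fg.
have g0 x : 0 <= g x by rewrite -(pmulr_rge0 _ c0) (le_trans _ (fg x)).
rewrite -ge0_integralZl ?lee_fin ?(ltW c0)//; last 2 first.
  exact/measurable_EFinP.
  by move=> x _; rewrite lee_fin.
rewrite -abse_EFin /Rintegral fineK; last exact: integrable_fin_num.
apply: (le_trans (le_abse_integral _ measurableT (measurable_int _ intf))).
apply: ge0_le_integral => //.
- by apply: measurableT_comp => //; exact: measurable_int intf.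
- by apply/measurable_EFinP; exact: measurable_funM.
- by move=> x _; rewrite lee_fin.
Qed.

Lemma normr_half_le (K : realType) (A : K) (B : \bar K) :
  (`|A|%:E <= 2%:E * B -> `|2^-1 * A|%:E <= B)%E.
Proof.
move=> AB; rewrite normrM ger0_norm// EFinM.
apply: le_trans; first by apply: lee_wpmul2l AB; rewrite lee_fin.
by rewrite muleA -EFinM mulVf// mul1e.
Qed.

Section derive_bound.
Context (K : realType) (sigma : K) (sigma_gt0 : 0 < sigma) (r l : {posnum K}).
Local Notation RT := (measurableTypeR K).
Local Notation mu := (quantized_law r l).
Local Notation phi := (@normal_pdf K 0 1).

Lemma normal_pdf_scale (m x : K) :
  phi ((x - m) / sigma) / sigma = normal_pdf m sigma x.
Proof.
have s0 : sigma != 0 by rewrite gt_eqF.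
rewrite normal_pdf01E normal_pdfE// /normal_fun mulrAC.
congr (_ * expR _); last by field.
rewrite /normal_peak expr1n mul1r -mulrnAr sqrtrM ?sqr_ge0// sqrtr_sqr gtr0_norm//.
by rewrite invfM mulrC.
Qed.

(** In v the integrand is the N(-m, sigma^2) density, of mass at most 1 on the dither range, and the
    dither density there is 1/(2L). This is the source of the factor 1/L. *)
Lemma dither_integral_normal_pdf_le (m : K) :
  (\int[dither_law l]_v (phi ((m + v) / sigma) / sigma)%:E <= ((2 * l%:num)^-1)%:E)%E.
Proof.
have -> : (fun v => (phi ((m + v) / sigma) / sigma)%:E) =
    (fun v => (normal_pdf (- m) sigma v)%:E).
  by apply/funext => v; rewrite -normal_pdf_scale opprK addrC.
have mp := @measurable_normal_pdf K (- m) sigma.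
rewrite integral_uniform; [|exact/measurable_EFinP|
  by move=> v; rewrite lee_fin normal_pdf_ge0].
rewrite (_ : l%:num - - l%:num = 2 * l%:num); last by ring.
rewrite -[leRHS]mule1.
rewrite lee_pmul2l ?lte_fin ?invr_gt0//.
rewrite -(integral_normal_pdf (- m) sigma).
apply: ge0_subset_integral => //; first exact/measurable_EFinP.
by move=> v _; rewrite lee_fin normal_pdf_ge0.
Qed.

Let norm_leE (x : K) :
  [set u : RT | `|u| <= `|x|] = [set` `[- `|x|, `|x|]].
Proof. by apply/seteqP; split=> u /=; rewrite in_itv/= ler_norml. Qed.

Let measurable_norm_le (x : K) : measurable [set u : RT | `|u| <= `|x|].
Proof. by rewrite norm_leE; exact: measurable_itv. Qed.

(** An interval of length 2|x| under a density that is at most 1/(2R); this is the source of the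
    factor 1/R. *)
Lemma dither_law_itv_le (x : K) :
  (dither_law r [set u | `|u| <= `|x|]%R <= (`|x| / r%:num)%:E)%E.
Proof.
have mS := measurable_norm_le x.
have muS : lebesgue_measure [set u : RT | `|u| <= `|x|] = (2 * `|x|)%:E.
  rewrite norm_leE (lebesgue_measure_itv `[- `|x|, `|x|])/= lte_fin.
  have [x0|x0] := ltP (- `|x|) `|x|; first by rewrite -EFinB; congr EFin; ring.
  by congr EFin; have := normr_ge0 x; lra.
have r0 : 0 < r%:num by [].
apply: (@le_trans _ _ (\int[lebesgue_measure]_(u in
    [set u : RT | `|u| <= `|x|]%R) ((2 * r%:num)^-1)%:E)%E).
  rewrite /dither_law /= /uniform_prob; apply: ge0_le_integral => //.
  - by move=> u _; rewrite lee_fin uniform_pdf_ge0// posnum_ltNr.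
  - by apply/measurable_EFinP/measurable_funTS; exact: measurable_uniform_pdf.
  - move=> u _; rewrite lee_fin /uniform_pdf.
    rewrite (_ : r%:num - - r%:num = 2 * r%:num); last by ring.
    by case: ifP => // _; rewrite invr_ge0 mulr_ge0.
rewrite integral_cst//; move: muS; rewrite /= => ->.
rewrite -EFinM lee_fin le_eqVlt; apply/orP; left; apply/eqP.
by field; rewrite gt_eqF.
Qed.

(** With [flip_dither] it generates the group of four symmetries over which [agree_kernel1] is
    averaged. *)
Definition neg_triple (z : RT * (RT * RT)) : RT * (RT * RT) :=
  (- z.1, (- z.2.1, - z.2.2)).
Definition flip_dither (z : RT * (RT * RT)) : RT * (RT * RT) :=
  (z.1, (- z.2.1, z.2.2)).

(** The last factor is the N(-X b, sigma^2) density at xi'. Given X, the dependence on xi and that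
    on xi' are in separate factors. *)
Definition symm_kernel b (z : RT * (RT * RT)) : K :=
  (`|z.2.1| <= `|z.1|)%R%:R *
  (`|z.1| * (phi ((z.1 * b + z.2.2) / sigma) / sigma)).

(* The four terms carry the signs of X + xi and of X - xi, which are opposite
   when |X| < |xi|. *)
Lemma agree_kernel1_symm b z :
  `|agree_kernel1 sigma b z + agree_kernel1 sigma b (neg_triple z) +
    (agree_kernel1 sigma b (flip_dither z) +
     agree_kernel1 sigma b (flip_dither (neg_triple z)))| <=
  2 * symm_kernel b z.
Proof.
case: z => [x [u v]]; rewrite /symm_kernel /agree_kernel1/=.
have -> : (- x * b - v) / sigma = - ((x * b + v) / sigma) by ring.
rewrite normal_pdf_opp; set P := phi _.
have -> : - x / sigma * P = - (x / sigma * P) by ring.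
set h := x / sigma * P.
have -> : `|x| * (P / sigma) = `|h|.
  rewrite /h !normrM normfV (gtr0_norm sigma_gt0).
  rewrite (ger0_norm (normal_pdf_ge0 _ _ _)).
  by rewrite -/P; ring.
clearbody h.
(* Two indicators enter with a plus and two with a minus, so their sum lies in [-2, 2]; hence the
   constant 2. *)
rewrite (_ : _ + _ = ((0 < x + u)%R%:R - (0 < - x - u)%R%:R +
  ((0 < x - u)%R%:R - (0 < - x - - u)%R%:R)) * h); last by ring.
rewrite normrM mulrA ler_wpM2r//.
have [_|] := leP `|u| `|x|.
  rewrite mulr1n mulr1; case: (0 < x + u); case: (0 < - x - u);
    case: (0 < x - u); case: (0 < - x - - u);
    rewrite ?mulr1n ?mulr0n ler_norml; apply/andP; split; lra.
rewrite ltr_norml mulr0.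
case: (ger0P u) => u0 /andP[h1 h2];
  case: ltP => h3; case: ltP => h4; case: ltP => h5; case: ltP => h6;
  rewrite ?mulr1n ?mulr0n ?normr_le0; try lra; apply/eqP; lra.
Qed.

Lemma measurable_neg_triple : measurable_fun setT neg_triple.
Proof.
have mN : measurable_fun setT (-%R : RT -> RT) by exact: oppr_measurable.
apply: measurable_fun_pair; first exact: measurableT_comp.
by apply: measurable_fun_pair; apply: measurableT_comp => //; exact: measurableT_comp.
Qed.

Lemma measurable_flip_dither : measurable_fun setT flip_dither.
Proof.
have mN : measurable_fun setT (-%R : RT -> RT) by exact: oppr_measurable.
apply: measurable_fun_pair => //.
by apply: measurable_fun_pair; [apply: measurableT_comp => //|]; exact: measurableT_comp.
Qed.

Lemma quantized_law_neg : measure_preserving mu neg_triple.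
Proof.
have mN : measurable_fun setT (-%R : RT -> RT) by exact: oppr_measurable.
apply: (measure_preserving_prod mN _ (@std_normal_oppr K)
  (measure_preserving_prod mN mN (@dither_oppr K r) (@dither_oppr K l))).
by apply: measurable_fun_pair; exact: measurableT_comp.
Qed.

Lemma quantized_law_flip : measure_preserving mu flip_dither.
Proof.
have mN : measurable_fun setT (-%R : RT -> RT) by exact: oppr_measurable.
have mid : measurable_fun setT (@id RT) by [].
have := measure_preserving_prod mid _
  (@measure_preserving_id _ _ _ (std_normal K))
  (measure_preserving_prod mN mid (@dither_oppr K r)
    (@measure_preserving_id _ _ _ (dither_law l))).
by apply; apply: measurable_fun_pair; [exact: measurableT_comp|].
Qed.

Lemma symm_kernel_ge0 b z : 0 <= symm_kernel b z.
Proof. by rewrite !mulr_ge0 ?normal_pdf_ge0 ?invr_ge0// ltW. Qed.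

Lemma measurable_symm_kernel b : measurable_fun setT (symm_kernel b).
Proof.
have mn : measurable_fun setT (fun z : RT * (RT * RT) => `|z.1|).
  exact: (measurableT_comp (@normr_measurable K setT)).
apply: measurable_funM.
  rewrite (_ : (fun z => _) =
    \1_(~` [set z : RT * (RT * RT) | `|z.1| < `|z.2.1|])); last first.
    by apply/funext => z; rewrite indicE in_setC mem_setE/= leNgt.
  apply: measurable_indic; apply: measurableC; apply: measurable_set_ltr => //.
  apply: (measurableT_comp (@normr_measurable K setT)); exact: measurableT_comp.
apply: measurable_funM => //; apply: measurable_funM => //.
apply: measurableT_comp; first exact: measurable_normal_pdf.
apply: measurable_funM => //.
apply: measurable_funD; first exact: measurable_funM.
exact: measurableT_comp.
Qed.

(** The kernel and its three transforms have equal integrals, so twice the integral of the kernel is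
    half that of their sum [S], and |S| is at most twice [symm_kernel]. *)
Lemma norm_integral_agree_kernel1_le b :
  (`|2 * \int[mu]_z agree_kernel1 sigma b z|%:E <=
   \int[mu]_z (symm_kernel b z)%:E)%E.
Proof.
have ik := @integrable_agree_kernel1 K sigma sigma_gt0 r l b.
have mneg := measurable_neg_triple; have mflip := measurable_flip_dither.
pose k := agree_kernel1 sigma b.
have pres (f : RT * (RT * RT) -> RT * (RT * RT)) :
    measurable_fun setT f -> measure_preserving mu f ->
    mu.-integrable setT (EFin \o (k \o f)) /\
    \int[mu]_z k (f z) = \int[mu]_z k z.
  move=> mf pf; split; last exact: (Rintegral_preserving mf pf ik).
  apply/integrableP; split.
    exact: (measurableT_comp (measurable_int _ ik) mf).
  have /integrableP[mk] := ik.
  by rewrite -(ge0_integral_preserving mf pf)//; exact: measurableT_comp.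
have [i1 e1] := pres _ mneg quantized_law_neg.
have [i2 e2] := pres _ mflip quantized_law_flip.
have [i3 e3] :
    mu.-integrable setT (EFin \o (k \o (flip_dither \o neg_triple))) /\
    \int[mu]_z k (flip_dither (neg_triple z)) = \int[mu]_z k z.
  apply: pres; first exact: measurableT_comp.
  move=> A mA; rewrite comp_preimage quantized_law_neg ?quantized_law_flip//.
  by rewrite -[X in measurable X]setTI; exact: mflip.
pose S z := k z + k (neg_triple z) +
  (k (flip_dither z) + k (flip_dither (neg_triple z))).
have iS : mu.-integrable setT (EFin \o S).
  by apply: (integrableD measurableT (integrableD measurableT ik i1)
    (integrableD measurableT i2 i3)).
have ES : \int[mu]_z S z = 4 * \int[mu]_z k z.
  have := RintegralD4 ik i1 i2 i3; rewrite /comp e1 e2 e3 -/k => E.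
  by apply: (etrans E); ring.
have -> : 2 * \int[mu]_z agree_kernel1 sigma b z = 2^-1 * \int[mu]_z S z.
  by rewrite ES -/k; field.
have mS := measurable_symm_kernel b.
exact: normr_half_le
  (norm_Rintegral_le (ltr0Sn K 1) iS mS (agree_kernel1_symm b)).
Qed.

(** Tonelli with xi' innermost, then xi, then X: xi' yields at most 1/(2L), the event |xi| <= |X| at
    most |X|/R, and the remaining factor |X| completes X^2. *)
Lemma integral_symm_kernel_le b :
  (\int[mu]_z (symm_kernel b z)%:E <=
   ((2 * l%:num * r%:num)^-1)%:E * \int[std_normal K]_x (x ^+ 2)%:E)%E.
Proof.
have mS : measurable_fun setT (fun z => (symm_kernel b z)%:E).
  by apply/measurable_EFinP; exact: measurable_symm_kernel.
have S0 z : (0 <= (symm_kernel b z)%:E)%E by rewrite lee_fin symm_kernel_ge0.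
have c0 : 0 <= (2 * l%:num * r%:num)^-1 by [].
rewrite -ge0_integralZl//; last 2 first.
  by apply/measurable_EFinP; exact: measurable_funX.
  by move=> x _; rewrite lee_fin sqr_ge0.
rewrite fubini_tonelli1//.
apply: ge0_le_integral => //.
- by move=> x _; apply: integral_ge0.
- exact: measurable_fun_fubini_tonelli_F.
- by apply/measurable_EFinP; apply: measurable_funM => //; exact: measurable_funX.
move=> x _; rewrite /fubini_F.
have mSx : measurable_fun setT (fun w => (symm_kernel b (x, w))%:E).
  exact: (measurableT_comp mS (pair1_measurable x)).
rewrite fubini_tonelli1//= /fubini_F/=.
have mv : measurable_fun setT (fun v : RT => (phi ((x * b + v) / sigma) / sigma)%:E).
  apply/measurable_EFinP; apply: measurable_funM => //.
  apply: measurableT_comp; first exact: measurable_normal_pdf.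
  by apply: measurable_funM => //; exact: measurable_funD.
have v0 v : (0 <= (phi ((x * b + v) / sigma) / sigma)%:E)%E.
  by rewrite lee_fin divr_ge0 ?normal_pdf_ge0// ltW.
have mI := measurable_norm_le x.
apply: (@le_trans _ _ (\int[dither_law r]_u ((`|x| * (2 * l%:num)^-1)%:E *
    (\1_[set u : RT | `|u| <= `|x|]%R u)%:E))%E).
  apply: ge0_le_integral => //.
  - by move=> u _; apply: integral_ge0.
  - exact: (@measurable_fun_fubini_tonelli_F _ _ _ _ _ _
      (fun y => (symm_kernel b (x, y))%:E)).
  - by apply: emeasurable_funM => //; apply/measurable_EFinP; exact: measurable_indic.
  move=> u _; rewrite /symm_kernel/= indicE mem_setE/=.
  under eq_integral do rewrite mulrA EFinM.
  rewrite ge0_integralZl; [|exact: measurableT|exact: mv|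
    by move=> v _; exact: v0|by rewrite lee_fin mulr_ge0].
  rewrite [leRHS](_ : _ =
    ((`|u| <= `|x|)%R%:R * `|x|)%:E * ((2 * l%:num)^-1)%:E)%E.
    apply: lee_wpmul2l; first by rewrite lee_fin mulr_ge0.
    exact: dither_integral_normal_pdf_le.
  by rewrite -!EFinM; congr EFin; ring.
have mind : measurable_fun setT
    (fun u : RT => (\1_[set u : RT | `|u| <= `|x|]%R u)%:E : \bar K).
  by apply/measurable_EFinP; exact: measurable_indic.
rewrite ge0_integralZl; [|exact: measurableT|exact: mind|
  by move=> u _; rewrite lee_fin|by rewrite lee_fin mulr_ge0].
rewrite -measure_integral_indic//.
apply: le_trans.
  by apply: lee_wpmul2l (dither_law_itv_le x); rewrite lee_fin mulr_ge0.
rewrite -!EFinM lee_fin -(real_normK (num_real x)) le_eqVlt.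
apply/orP; left; apply/eqP.
by field; rewrite !gt_eqF.
Qed.

Lemma derive1_agree_prob_le b :
  `|(agree_prob sigma r l)^`()%classic b| <=
  fine (\int[std_normal K]_x (x ^+ 2)%:E)%E / (2 * l%:num * r%:num).
Proof.
rewrite derive1_agree_prob// -lee_fin.
apply: le_trans (norm_integral_agree_kernel1_le b) _.
apply: le_trans (integral_symm_kernel_le b) _.
rewrite (mulrC (fine _)) EFinM fineK//.
exact: (integrable_fin_num measurableT (@integrable_std_normal_sqr K)).
Qed.

End derive_bound.

(** * Lower bounds for the sign patterns *)

Lemma std_normal_itv_gt0 (K : realType) (a : K) : 0 < a ->
  (0 < std_normal K [set` `]0%R, a[])%E.
Proof.
move=> a0; have mp := @measurable_normal_pdf K 0 1.
(* The normal density decreases on the positive half-line, so on the interval it is at least its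
   value at [a]. *)
apply: (@lt_le_trans _ _
  (\int[lebesgue_measure]_(x in `]0%R, a[) (normal_pdf 0 1 a)%:E)%E).
  rewrite integral_cst//= (lebesgue_measure_itv `]0, a[)/= lte_fin a0 oppr0 adde0.
  rewrite -EFinM lte_fin mulr_gt0// normal_pdf01E mulr_gt0 ?expR_gt0//.
  by rewrite normal_peak_gt0 ?oner_neq0.
apply: ge0_le_integral => //.
- by move=> x _; rewrite lee_fin normal_pdf_ge0.
- by apply/measurable_EFinP/measurable_funTS.
move=> x /=; rewrite in_itv/= => /andP[x0 xa].
rewrite lee_fin !normal_pdf01E ler_wpM2l ?normal_peak_ge0// ler_expR lerN2.
by rewrite ler_pM2r ?invr_gt0// ler_sqr ?nnegrE ?ltW.
Qed.

(** The mass is free of [r], which makes the lower bounds below uniform in the ranges. *)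
Lemma dither_law_gt (K : realType) (r : {posnum K}) (c : K) : 0 <= c < 1 ->
  dither_law r [set u | c * r%:num < u] = ((1 - c) / 2)%:E.
Proof.
move=> /andP[c0 c1]; have r0 : 0 < r%:num by [].
rewrite /dither_law /= /uniform_prob integral_uniform_pdf.
have -> : [set u | c * r%:num < u] `&` `[- r%:num, r%:num] =
    [set` `]c * r%:num, r%:num]].
  apply/seteqP; split=> u /=; rewrite !in_itv/=.
    by move=> [-> /andP[_ ->]].
  by move=> /andP[h ->]; split => //; rewrite andbT; nra.
rewrite (eq_integral (cst ((2 * r%:num)^-1)%:E)); last first.
  move=> u; rewrite inE/= in_itv/= => /andP[h1 h2]; rewrite /uniform_pdf h2 andbT.
  rewrite ifT; last by nra.
  by congr (_^-1%:E); ring.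
rewrite integral_cst//= (lebesgue_measure_itv `]c * r%:num, r%:num])/= lte_fin.
rewrite ifT; last by nra.
by rewrite -EFinB -EFinM; congr EFin; field; rewrite gt_eqF.
Qed.

(** Disjointness gives 2 P(A) + P(C) <= 1. Meant for [A], [B] the two agreeing sign patterns and [C]
    a disagreeing one. *)
Lemma twice_probability_bounds d (T : measurableType d) (K : realType)
    (P : probability T K) (A B C : set T) (delta : K) :
  measurable A -> measurable B -> measurable C ->
  A `&` B = set0 -> (A `|` B) `&` C = set0 -> P B = P A ->
  0 < delta -> (delta%:E <= P A)%E -> (delta%:E <= P C)%E ->
  delta <= 2 * fine (P A) <= 1 - delta.
Proof.
move=> mA mB mC AB ABC PBA d0 dA dC.
have : (P A + P A + P C <= 1)%E.
  rewrite -{2}PBA -measureU// -measureU//; last exact: measurableU.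
  by apply: probability_le1; apply: measurableU => //; exact: measurableU.
move: dA dC; rewrite -(fineK (fin_num_measure P _ mA)).
rewrite -(fineK (fin_num_measure P _ mC)).
rewrite /=; move: (fine (P A)) (fine (P C)) => x y.
rewrite -!EFinD !lee_fin => dx dy xy.
by apply/andP; split; lra.
Qed.

Section agree_prob_bounds.
Context (K : realType) (sigma : K) (sigma_gt0 : 0 < sigma).
Local Notation RT := (measurableTypeR K).

(** If X and eps lie in ]0, a[, then X > 0 and |Y| < l0/2 <= l/2. If moreover xi > 0 and t xi' >
    l/2, the dithers fix the sign pattern as (1, t). *)
Lemma prob_beta_quadrant_ge (b l0 : K) : 0 < l0 ->
  exists2 delta : K, 0 < delta &
    forall (r l : {posnum K}) (t : K), l0 <= l%:num -> t = 1 \/ t = - 1 ->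
      (delta%:E <= prob_beta sigma r l b (quadrant 1 t))%E.
Proof.
(* Chosen so that |x b + sigma e| < a (|b| + sigma) = l0/2 for x, e in ]0, a[. *)
move=> l0_gt0; pose a := l0 / (2 * (`|b| + sigma)).
have bs : 0 < `|b| + sigma by rewrite ltr_wpDl.
have a0 : 0 < a by rewrite divr_gt0// mulr_gt0.
have aE : a * (`|b| + sigma) = l0 / 2 by rewrite /a; field; rewrite gt_eqF.
pose A := [set` `]0, a[] : set RT.
have mA : measurable A by exact: measurable_itv.
have N0 : 0 < fine (std_normal K A).
  by rewrite fine_gt0// std_normal_itv_gt0// ltey_eq fin_num_measure.
(* The product of the probabilities that X and eps lie in ]0, a[, that xi > 0 and that t xi' >
   l/2. *)
exists (fine (std_normal K A) * fine (std_normal K A) * (2^-1 * 4^-1)).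
  by rewrite !mulr_gt0.
move=> r l t l0l tE.
pose B := [set y : RT | `|y| < l0 / 2].
have mB : measurable B.
  exact: (measurable_set_ltr (@normr_measurable K setT) (measurable_cst (l0 / 2))).
have mX : measurable [set x : RT | 0 < x] by rewrite -set_itvoy; exact: measurable_itv.
pose V := [set v : RT | 2^-1 * l%:num < t * v].
have mV : measurable V.
  by apply: measurable_set_ltr => //; exact: measurable_funM.
have UV : dither_law l V = (4^-1)%:E.
  have h : dither_law l [set u | 2^-1 * l%:num < u] = (4^-1)%:E.
    by rewrite dither_law_gt; [congr EFin; field|apply/andP; split; lra].
  rewrite -h; case: tE => tE; rewrite /V tE.
    by congr (dither_law l _); apply/seteqP; split=> v /=; rewrite mul1r.
  have m2 : measurable [set u : RT | 2^-1 * l%:num < u].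
    by rewrite -set_itvoy; exact: measurable_itv.
  rewrite -(dither_oppr l m2).
  by congr (dither_law l _); apply/seteqP; split=> v /=; rewrite mulN1r.
have UX : dither_law r [set x : RT | 0 < x] = (2^-1)%:E.
  have := @dither_law_gt K r 0; rewrite mul0r => ->; last by apply/andP; split; lra.
  by congr EFin; field.
have regA : (std_normal K A * std_normal K A <=
    regression_law b sigma ([set x : RT | 0 < x]%R `*` B))%E.
  rewrite /regression_law /distribution /pushforward/=.
  have <- : (std_normal K \x std_normal K)%E (A `*` A) =
      (std_normal K A * std_normal K A)%E.
    exact: product_measure1E.
  apply: le_measure; rewrite ?inE.
  - exact: measurableX.
  - rewrite -[X in measurable X]setTI; apply: measurable_regression_map => //.
    exact: measurableX.
  move=> [x e] /= []; rewrite /A /= !in_itv/=.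
  move=> /andP[x0 xa] /andP[e0 ea]; split => //.
  rewrite /B/= -aE mulrDr; apply: le_lt_trans (ler_normD _ _) _.
  rewrite !normrM (gtr0_norm x0) (gtr0_norm e0) (gtr0_norm sigma_gt0).
  by apply: ler_ltD; [rewrite ler_wpM2r// ltW|rewrite mulrC ltr_pM2r].
apply: (@le_trans _ _ (prob_beta sigma r l b
    (([set x : RT | 0 < x] `*` B) `*` ([set x : RT | 0 < x] `*` V)))).
  have E1 : prob_beta sigma r l b
      (([set x : RT | 0 < x] `*` B) `*` ([set x : RT | 0 < x] `*` V)) =
      (regression_law b sigma ([set x : RT | 0 < x]%R `*` B) *
       (dither_law r \x dither_law l) ([set x : RT | 0 < x]%R `*` V))%E.
    by apply: product_measure1E; exact: measurableX.
  have E2 : ((dither_law r \x dither_law l) ([set x : RT | 0 < x]%R `*` V) =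
      (2^-1 * 4^-1)%:E)%E.
    transitivity (dither_law r [set x : RT | 0 < x]%R * dither_law l V)%E.
      exact: product_measure1E.
    by rewrite [X in (X * _)%E]UX [X in (_ * X)%E]UV.
  rewrite E1 E2 EFinM; apply: lee_wpmul2r; first by rewrite lee_fin.
  by apply: le_trans regA; rewrite EFinM !fineK// fin_num_measure.
apply: le_measure; rewrite ?inE.
- by apply: measurableX; exact: measurableX.
- exact: measurable_quadrant.
move=> [[x y] [u v]]; rewrite /quadrant /B /V /= => -[[x0 yB] [u0 vV]]; split.
  by rewrite mul1r addr_gt0.
move: yB; rewrite ltr_norml => /andP[y1 y2].
by case: tE vV => -> ; nra.
Qed.

Lemma agree_prob_bounds (b l0 : K) : 0 < l0 ->
  exists2 delta : K, 0 < delta &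
    forall r l : {posnum K}, l0 <= l%:num ->
      delta <= agree_prob sigma r l b <= 1 - delta.
Proof.
move=> l0_gt0; have [delta d0 dP] := prob_beta_quadrant_ge b l0_gt0.
exists delta => // r l l0l; rewrite agree_prob_quadrant.
have mQ := @measurable_quadrant K.
have disj2 : (quadrant 1 1 `|` quadrant (- 1) (- 1)) `&`
    quadrant (1 : K) (- 1) = set0.
  rewrite -subset0 => w [] /=; rewrite /quadrant/= !mul1r !mulN1r.
  by case=> [[? ?] [? ?]|[? ?] [? ?]]; lra.
exact: (@twice_probability_bounds _ _ _ (prob_beta sigma r l b) _ _ _ delta
  (mQ 1 1) (mQ (- 1) (- 1)) (mQ 1 (- 1)) (@quadrant_disjoint K) disj2
  (prob_beta_quadrantNN sigma r l b) d0 (dP r l 1 l0l (or_introl erefl))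
  (dP r l (- 1) l0l (or_intror erefl))).
Qed.

End agree_prob_bounds.

(** * The law of one observation *)

Section joint_law.
Context (K : realType).

(** Uniqueness of product measures. Measures more general than probabilities are allowed because the
    next lemma applies it to a restriction of [P] and a multiple of [m2]. *)
Lemma measure_pair_eq_prod d d1 d2 (T : measurableType d)
    (T1 : measurableType d1) (T2 : measurableType d2)
    (P : {measure set T -> \bar K})
    (m1 : {sigma_finite_measure set T1 -> \bar K})
    (m2 : {sigma_finite_measure set T2 -> \bar K})
    (f1 : T -> T1) (f2 : T -> T2) :
  measurable_fun setT f1 -> measurable_fun setT f2 ->
  (forall A B, measurable A -> measurable B ->
    P (f1 @^-1` A `&` f2 @^-1` B) = m1 A * m2 B)%E ->
  forall S, measurable S -> P [set w | S (f1 w, f2 w)] = (m1 \x m2)%E S.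
Proof.
move=> mf1 mf2 H S mS.
have mf : measurable_fun setT (fun w => (f1 w, f2 w)) by exact: measurable_fun_pair.
pose F := mfun_Sub (mem_set mf).
transitivity (pushforward P F S); first by [].
by apply/esym/product_measure_unique.
Qed.

(** For fixed [A], restricting [P] to the event f1 in A gives (f2, f3) the law m1(A) m2 x m3 by the
    two-factor case; a second use of that case adds the first coordinate. *)
Lemma probability_triple_eq_prod d d1 d2 d3 (T : measurableType d)
    (T1 : measurableType d1) (T2 : measurableType d2) (T3 : measurableType d3)
    (P : probability T K) (m1 : probability T1 K) (m2 : probability T2 K)
    (m3 : probability T3 K) (m23 : probability (T2 * T3)%type K)
    (f1 : T -> T1) (f2 : T -> T2) (f3 : T -> T3) :
  measurable_fun setT f1 -> measurable_fun setT f2 -> measurable_fun setT f3 ->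
  (forall A, m23 A = (m2 \x m3)%E A) ->
  (forall A B C, measurable A -> measurable B -> measurable C ->
    P [set w | [/\ A (f1 w), B (f2 w) & C (f3 w)]] = m1 A * m2 B * m3 C)%E ->
  forall S, measurable S ->
    P [set w | S (f1 w, (f2 w, f3 w))] = (m1 \x m23)%E S.
Proof.
move=> mf1 mf2 mf3 m23E H S mS.
have mf23 : measurable_fun setT (fun w => (f2 w, f3 w)) by exact: measurable_fun_pair.
apply: (measure_pair_eq_prod mf1 mf23) => // A B mA mB.
pose k : {nonneg K} := NngNum (fine_ge0 (measure_ge0 m1 A)).
have mE : measurable (f1 @^-1` A) by rewrite -[X in measurable X]setTI; exact: mf1.
have kE : (k%:num%:E = m1 A)%E by rewrite /= fineK// fin_num_measure.
transitivity (mrestr P mE [set w | B (f2 w, f3 w)]).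
  by rewrite /mrestr setIC.
transitivity ((mscale k m2 \x m3)%E B); last first.
  rewrite [LHS]ge0_integral_mscale//; last exact: measurable_fun_xsection.
  by congr (_ * _)%E; [exact: kE|exact/esym/m23E].
apply: (@measure_pair_eq_prod _ _ _ _ _ _ (mrestr P mE) (mscale k m2) m3) => //.
move=> C D mC mD.
transitivity (P [set w | [/\ A (f1 w), C (f2 w) & D (f3 w)]]).
  rewrite /mrestr; congr (P _).
  by apply/seteqP; split=> w /= => [[[? ?] ?]|[? ? ?]].
by rewrite H// -kE.
Qed.

(** The sets of every index other than [i] are taken to be [setT], so their factors equal 1. *)
Lemma single_indep d (T : measurableType d) (P : probability T K) (n : nat)
    (X Y xi xi' : 'I_n -> {RV P >-> K}) (i : 'I_n) A B C :
  indep_sample X Y xi xi' -> measurable A -> measurable B -> measurable C ->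
  P [set w | [/\ A (X i w, Y i w), B (xi i w) & C (xi' i w)]] =
  (P [set w | A (X i w, Y i w)] * P [set w | B (xi i w)] *
   P [set w | C (xi' i w)])%E.
Proof.
move=> ind mA mB mC.
pose AA j := if j == i then A else setT.
pose BB j := if j == i then B else setT.
pose CC j := if j == i then C else setT.
have := ind AA BB CC.
rewrite (bigD1 i)//= big1 ?mule1; last first.
  move=> j /negbTE ji; rewrite /AA /BB /CC ji.
  transitivity (P setT * P setT * P setT)%E; first by [].
  by rewrite probability_setT !mule1.
rewrite /AA /BB /CC eqxx => <-.
- congr (P _); apply/seteqP; split => w /=; last by move=> /(_ i); rewrite eqxx.
  by move=> h j; case: eqVneq => [->|].
- by move=> j; case: ifP.
- by move=> j; case: ifP.
- by move=> j; case: ifP.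
Qed.

Context d (T : measurableType d) (P : probability T K) (n : nat)
  (beta sigma : K) (r l : {posnum K}) (X Y xi xi' : 'I_n -> {RV P >-> K}).
Hypothesis sample : dithered_sample beta sigma r l X Y xi xi'.

Lemma sample_law (i : 'I_n) S : measurable S ->
  P [set w | S ((X i w, Y i w), (xi i w, xi' i w))] =
  prob_beta sigma r l beta S.
Proof.
case: sample => XYE xiE xi'E ind mS.
pose Z w : measurableTypeR K * measurableTypeR K := (X i w, Y i w).
have mZ : measurable_fun setT Z.
  exact: (measurable_fun_pair (measurable_funPT (X i)) (measurable_funPT (Y i))).
have H (A : set (measurableTypeR K * measurableTypeR K)%type)
    (B C : set (measurableTypeR K)) :
    measurable A -> measurable B -> measurable C ->
    P [set w | [/\ A (X i w, Y i w), B (xi i w) & C (xi' i w)]] =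
    (regression_law beta sigma A * dither_law r B * dither_law l C)%E.
  move=> mA mB mC; apply: (etrans (single_indep i ind mA mB mC)).
  by congr (_ * _ * _)%E; [exact: XYE|exact: xiE|exact: xi'E].
have mxi : measurable_fun setT (xi i : T -> measurableTypeR K) :=
  measurable_funPT (xi i).
have mxi' : measurable_fun setT (xi' i : T -> measurableTypeR K) :=
  measurable_funPT (xi' i).
exact: (@probability_triple_eq_prod _ _ _ _ _ _ _ _ P (regression_law beta sigma)
  (dither_law r) (dither_law l) (dither_law r \x dither_law l)%E
  Z _ _ mZ mxi mxi' (fun A => erefl) H S mS).
Qed.

End joint_law.

(** * The event of sign agreement and its probability *)

Lemma measurable_set_eqr d (T : measurableType d) (K : realType) (f g : T -> K) :
  measurable_fun setT f -> measurable_fun setT g ->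
  measurable [set x | f x = g x].
Proof.
move=> mf mg.
rewrite (_ : [set x | _] = ~` ([set x | f x < g x] `|` [set x | g x < f x])).
  by apply: measurableC; apply: measurableU; exact: measurable_set_ltr.
apply/seteqP; split=> x /=; first by move=> ->; rewrite ltxx => -[].
by move/not_orP => [/negP h1 /negP h2]; apply/le_anti; rewrite !leNgt h1 h2.
Qed.

Lemma sgr_quantize (K : realType) (r : {posnum K}) (x u : K) :
  Num.sg (quantize r x u) = Num.sg (x + u).
Proof. by rewrite /quantize sgrM gtr0_sg// mul1r sgr_id. Qed.

(** The factors 1 and -1 are left unsimplified to match [quadrant]. *)
Lemma eq_sgrP (K : realType) (a b : K) : (Num.sg a == Num.sg b) <->
  (0 < 1 * a /\ 0 < 1 * b \/ 0 < - 1 * a /\ 0 < - 1 * b) \/ (a = 0 /\ b = 0).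
Proof.
rewrite !mul1r !mulN1r !oppr_gt0; split.
  case: (sgrP a) => [->|a0|a0]; rewrite eq_sym.
  - by rewrite sgr_eq0 => /eqP; right.
  - by rewrite sgr_cp0; left; left.
  - by rewrite sgr_cp0; left; right.
case=> [[[a0 b0]|[a0 b0]]|[-> ->]//].
  by rewrite !gtr0_sg.
by rewrite !ltr0_sg.
Qed.

Section sign_agree.
Context (K : realType) (sigma : K) (r l : {posnum K}).
Local Notation RT := (measurableTypeR K).

Lemma dither_law_set1 (a : K) : dither_law r [set a] = 0%E.
Proof.
apply: null_set_integral.
- exact: measurable_set1.
- by apply/measurable_EFinP/measurable_funTS; exact: measurable_uniform_pdf.
- exact: lebesgue_measure_set1.
Qed.

Definition zero_event : set ((RT * RT) * (RT * RT)) :=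
  [set w | w.1.1 + w.2.1 = 0].

Lemma measurable_zero_event : measurable zero_event.
Proof.
apply: measurable_set_eqr => //.
by apply: measurable_funD; apply: measurableT_comp.
Qed.

(** Given (X, Y), the event forces xi = -X, and the uniform law has no atoms. *)
Lemma prob_beta_zero_event b : prob_beta sigma r l b zero_event = 0%E.
Proof.
transitivity (\int[regression_law b sigma]_z 0)%E; last by rewrite integral0.
apply: eq_integral => z _ /=.
transitivity ((dither_law r \x dither_law l)%E ([set - z.1] `*` setT)).
  congr ((_ \x _)%E _); apply/seteqP.
  split=> w /=; rewrite /xsection/= inE /zero_event/=.
    by move=> h; split => //; lra.
  by move=> [-> _]; rewrite subrr.
transitivity (dither_law r [set - z.1]%R * dither_law l setT)%E.
  by apply: product_measure1E => //; exact: measurable_set1.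
by rewrite [X in (X * _)%E]dither_law_set1 mul0e.
Qed.

Definition agree_event : set ((RT * RT) * (RT * RT)) :=
  [set w | Num.sg (quantize r w.1.1 w.2.1) == Num.sg (quantize l w.1.2 w.2.2)].

Let both_zero : set ((RT * RT) * (RT * RT)) :=
  zero_event `&` [set w | w.1.2 + w.2.2 = 0].

Let measurable_both_zero : measurable both_zero.
Proof.
apply: measurableI; first exact: measurable_zero_event.
apply: measurable_set_eqr => //.
by apply: measurable_funD; apply: measurableT_comp.
Qed.

(* As Num.sg 0 = 0, the signs also agree when both quantized values vanish. *)
Lemma agree_eventE : agree_event = quadrant 1 1 `|` quadrant (- 1) (- 1) `|` both_zero.
Proof.
apply/seteqP; split=> w; rewrite /agree_event/= !sgr_quantize; by move/eq_sgrP.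
Qed.

Lemma measurable_agree_event : measurable agree_event.
Proof.
rewrite agree_eventE; apply: measurableU; last exact: measurable_both_zero.
by apply: measurableU; exact: measurable_quadrant.
Qed.

(** Up to a null event, agreement is the union of two disjoint quadrants of equal probability; hence
    the factor 2 in [agree_prob]. *)
Lemma prob_beta_agree_event b :
  prob_beta sigma r l b agree_event = (agree_prob sigma r l b)%:E.
Proof.
have mQ := @measurable_quadrant K.
have mZ := measurable_both_zero.
have Z0 : prob_beta sigma r l b both_zero = 0%E.
  apply: (subset_measure0 mZ measurable_zero_event); first exact: subIsetl.
  exact: prob_beta_zero_event.
have mQQ : measurable (quadrant 1 1 `|` quadrant (- 1 : K) (- 1)).
  exact: measurableU.
rewrite agree_eventE agree_prob_quadrant.
transitivity (prob_beta sigma r l b (quadrant 1 1 `|` quadrant (- 1) (- 1))).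
  exact: measureU0.
transitivity (prob_beta sigma r l b (quadrant 1 1) +
              prob_beta sigma r l b (quadrant (- 1) (- 1)))%E.
  exact: measureU (@quadrant_disjoint K).
rewrite prob_beta_quadrantNN EFinM fineK; last exact: fin_num_measure.
by rewrite mule_natl mule2n.
Qed.

End sign_agree.

(** * The log-likelihood *)

Lemma ln_prod (K : realType) (n : nat) (F : 'I_n -> K) :
  (forall i, 0 < F i) -> ln (\prod_(i < n) F i) = \sum_(i < n) ln (F i).
Proof.
move=> F0.
suff : 0 < \prod_(i < n) F i /\ ln (\prod_(i < n) F i) = \sum_(i < n) ln (F i) by case.
elim/big_ind2 : _ => //.
- by rewrite ln1.
- by move=> x1 x2 y1 y2 [h1 <-] [h2 <-]; rewrite mulr_gt0// lnM// posrE.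
Qed.

Lemma is_derive_ln_comp (K : realType) (q : K -> K) (b dq : K) :
  0 < q b -> is_derive b 1 q dq -> is_derive b 1 (fun x => ln (q x)) (dq / q b).
Proof.
move=> q0 dqE; have dln := is_derive1_ln q0.
by have := is_derive1_comp dln dqE; rewrite mulrC.
Qed.

Lemma is_derive_log_derive (K : realType) (q q1 : K -> K) (b q2 : K) :
  q b != 0 -> is_derive b 1 q (q1 b) -> is_derive b 1 q1 q2 ->
  is_derive b 1 (fun x => q1 x / q x) ((q2 * q b - q1 b ^+ 2) / q b ^+ 2).
Proof.
move=> q0 dq dq1.
have dV := is_deriveV q0 dq; apply: is_derive_eq.
rewrite /GRing.scale/=; field.
exact: q0.
Qed.

Lemma is_derive_sum_fct (K : realType) (n : nat) (h : 'I_n -> K -> K)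
    (dh : 'I_n -> K) (b : K) :
  (forall i, is_derive b 1 (h i) (dh i)) ->
  is_derive b 1 (fun x => \sum_(i < n) h i x) (\sum_(i < n) dh i).
Proof.
move=> hdh; rewrite (_ : (fun x => _) = \sum_(i < n) h i).
  exact: is_derive_sum.
by apply/funext => x; rewrite fct_sumE.
Qed.

Section loglik.
Context (K : realType) (p : K -> K) (b0 : K) (n : nat) (c : 'I_n -> bool).
Hypothesis p01 : forall b, 0 < p b < 1.
Hypothesis dp : forall b : K, derivable p b 1.
Hypothesis ddp : derivable (p^`())%classic b0 1.

(** The i-th factor of the likelihood, its exponents replaced by a case distinction. *)
Let q (i : 'I_n) (b : K) := if c i then p b else 1 - p b.
Let q1 (i : 'I_n) (b : K) := if c i then (p^`())%classic b else - (p^`())%classic b.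
Let p2 := ((p^`())^`())%classic b0.

Let q_gt0 i b : 0 < q i b.
Proof. by have /andP[h1 h2] := p01 b; rewrite /q; case: ifP => _; lra. Qed.

Let is_derive_p (b : K) : is_derive b 1 p (p^`()%classic b).
Proof. by rewrite derive1E; apply: DeriveDef. Qed.

Let is_derive_q i (b : K) : is_derive b 1 (q i) (q1 i b).
Proof.
rewrite /q /q1; case: ifP => _; first exact: is_derive_p.
have := is_derive_p b => h.
by rewrite -[fun x => _]/(cst 1 - p); apply: is_derive_eq; rewrite sub0r.
Qed.

Let is_derive_q1 i : is_derive b0 1 (q1 i) (if c i then p2 else - p2).
Proof.
have h : is_derive b0 1 (p^`()%classic) p2 by rewrite /p2 derive1E; apply: DeriveDef.
rewrite /q1; case: ifP => _; first exact: h.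
by rewrite -[fun x => _]/(- (p^`()%classic)); exact: is_deriveN.
Qed.

(** The log-likelihood is a sum of terms ln q, each with second derivative q''/q - (q'/q)^2.
    Positivity of q at every [b] identifies the first derivative as a function, which can then be
    differentiated again. *)
Lemma derive2_loglik :
  ((fun b => ln (\prod_(i < n)
    (p b ^+ c i * (1 - p b) ^+ (1 - c i)%N)))^`(2))%classic b0 =
  \sum_(i < n) (if c i then p2 / p b0 - (p^`()%classic b0 / p b0) ^+ 2
    else - p2 / (1 - p b0) - (p^`()%classic b0 / (1 - p b0)) ^+ 2).
Proof.
have -> : (fun b => ln (\prod_(i < n) (p b ^+ c i * (1 - p b) ^+ (1 - c i)%N))) =
    fun b => \sum_(i < n) ln (q i b).
  apply/funext => b; rewrite -ln_prod//; congr ln.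
  apply: eq_bigr => i _; rewrite /q.
  by case: (c i); rewrite ?expr1 ?expr0 ?mulr1 ?mul1r.
have dlq i (b : K) : is_derive b 1 (fun x => ln (q i x)) (q1 i b / q i b).
  exact: is_derive_ln_comp.
rewrite derive1nS derive1n1.
have -> : ((fun b => \sum_(i < n) ln (q i b))^`())%classic =
    fun b => \sum_(i < n) q1 i b / q i b.
  apply/funext => b; rewrite derive1E.
  exact: (@derive_val _ _ _ _ _ _ _ (is_derive_sum_fct (fun i => dlq i b))).
have ddlq i := is_derive_log_derive (lt0r_neq0 (q_gt0 i b0))
  (is_derive_q i b0) (is_derive_q1 i).
rewrite derive1E (@derive_val _ _ _ _ _ _ _ (is_derive_sum_fct ddlq)).
apply: eq_bigr => i _; rewrite /q /q1; have /andP[h1 h2] := p01 b0.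
case: (c i); field; rewrite gt_eqF//; lra.
Qed.

End loglik.

(** * A positive lower bound on the range L, uniform in n *)

Lemma ln3_gt1 (K : realType) : 1 < ln 3 :> K.
Proof.
(* From exp(-1/6) >= 5/6. The sixth power gives e <= (6/5)^6 = 2.985984 < 3. *)
have e6 : expR (6^-1) <= 6 / 5 :> K.
  rewrite -[6^-1]opprK expRN invf_ple ?posrE ?expR_gt0//.
  by have := expR_ge1Dx (- 6^-1 : K); lra.
rewrite -[ltLHS]expRK ltr_ln ?posrE ?expR_gt0//.
have -> : expR 1 = expR (6^-1) ^+ 6 :> K.
  by rewrite -expRM_natr; congr expR; field.
apply: (@le_lt_trans _ _ ((6 / 5) ^+ 6)); last by lra.
by rewrite lerXn2r ?nnegrE ?expR_ge0.
Qed.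

Lemma dither_range_ge (K : realType) (s : K) (n : nat) : 0 <= s -> (3 <= n)%N ->
  Num.sqrt (s * (ln (ln 3) `^ 2^-1)) <= Num.sqrt (s * (ln (ln n%:R) `^ 2^-1)).
Proof.
move=> s0 n3; have l3 := ln3_gt1 K.
have n3' : 3 <= n%:R :> K by rewrite ler_nat.
have ln3n : ln 3 <= ln n%:R :> K.
  by rewrite ler_ln ?posrE// (lt_le_trans _ n3').
have lnn : 1 < ln n%:R :> K by exact: lt_le_trans ln3n.
rewrite ler_wsqrtr// ler_wpM2l// ge0_ler_powR ?nnegrE ?invr_ge0//.
- by rewrite ltW// ln_gt0.
- by rewrite ltW// ln_gt0.
- by rewrite ler_ln ?posrE// (lt_trans _ l3, lt_trans _ lnn).
Qed.

(** * Expectation of the observed information *)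

Section expectation.
Local Open Scope ereal_scope.

(** Each summand is the affine function B + (A - B) 1(c_i) of an indicator with mean [x]. *)
Lemma expectation_sum_if d (T : measurableType d) (K : realType)
    (P : probability T K) (n : nat) (c : T -> 'I_n -> bool) (x A B : K) :
  (forall i, measurable [set w | c w i]) -> (forall i, P [set w | c w i] = x%:E) ->
  'E_P[fun w => \sum_(i < n) (if c w i then A else B)]%R =
  (n%:R * (A * x + B * (1 - x)))%:E.
Proof.
move=> mc Pc; rewrite unlock.
have ifE i w : (if c w i then A else B)%:E =
    B%:E + (A - B)%:E * (\1_[set w | c w i] w)%:E.
  rewrite indicE (_ : (w \in _) = c w i); last by apply/idP/idP; rewrite inE.
  rewrite -EFinM -EFinD; congr EFin.
  by case: (c w i); rewrite ?mulr1n ?mulr0n; ring.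
have ii i : P.-integrable setT (fun w => (if c w i then A else B)%:E).
  under eq_fun do rewrite ifE.
  apply: integrableD => //; first exact: finite_measure_integrable_cst.
  by apply: integrableZl => //; exact: integrable_indic.
have Ei i : \int[P]_w (if c w i then A else B)%:E = (B + (A - B) * x)%R%:E.
  under eq_integral do rewrite ifE.
  rewrite integralD//; last 2 first.
    exact: finite_measure_integrable_cst.
    by apply: integrableZl => //; exact: integrable_indic.
  rewrite integralZl//; last exact: integrable_indic.
  have -> : \int[P]_w (\1_[set w | c w i] w)%:E = x%:E.
    by rewrite -(Pc i); exact/esym/measure_integral_indic.
  have -> : \int[P]_w (EFin \o cst B) w = B%:E.
    transitivity (B%:E * P setT); first exact: (integral_cst P measurableT B%:E).
    by rewrite -[RHS]mule1; congr (_ * _); exact: probability_setT.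
  by rewrite -EFinM -EFinD.
under eq_integral do rewrite -sumEFin.
rewrite integral_sum// (eq_bigr _ (fun i _ => Ei i)) sumEFin sumr_const card_ord.
by congr EFin; rewrite -mulr_natl; ring.
Qed.

End expectation.

Section sample_agree.
Context (K : realType) d (T : measurableType d) (P : probability T K) (n : nat)
  (beta sigma : K) (r l : {posnum K}) (X Y xi xi' : 'I_n -> {RV P >-> K}).
Hypothesis sample : dithered_sample beta sigma r l X Y xi xi'.

Lemma measurable_sign_agree i : measurable [set w | sign_agree r l X Y xi xi' w i].
Proof.
have mW : measurable_fun setT (fun w => ((X i w, Y i w), (xi i w, xi' i w)) :
    (measurableTypeR K * measurableTypeR K) *
    (measurableTypeR K * measurableTypeR K)).
  apply: measurable_fun_pair.
    exact: (measurable_fun_pair (measurable_funPT (X i)) (measurable_funPT (Y i))).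
  exact: (measurable_fun_pair (measurable_funPT (xi i)) (measurable_funPT (xi' i))).
have := mW measurableT _ (measurable_agree_event r l); rewrite setTI; exact.
Qed.

Lemma sample_sign_agree i :
  P [set w | sign_agree r l X Y xi xi' w i] = (agree_prob sigma r l beta)%:E.
Proof.
rewrite -prob_beta_agree_event.
by rewrite -(sample_law sample i (measurable_agree_event r l)).
Qed.

End sample_agree.

Theorem theorem3 (K : realType) (bstar sigma : K) (sigma_gt0 : 0 < sigma) :
  exists C : K,
  forall R L : nat -> {posnum K},
  (forall n : nat, (3 <= n)%N ->
    Num.sqrt (2 * (sigma ^+ 2 + bstar ^+ 2) * (ln (ln n%:R) `^ 2^-1))
      <= (L n)%:num) ->
  ((fun n => (R n)%:num) : nat -> K) =O_\oo
    ((fun n => Num.sqrt (ln n%:R)) : nat -> K) ->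
  forall n : nat, (3 <= n)%N ->
  forall (d : measure_display) (T : measurableType d) (P : probability T K)
    (X Y xi xi' : 'I_n -> {RV P >-> K}),
  dithered_sample bstar sigma (R n) (L n) X Y xi xi' ->
  let p : K -> K := agree_prob sigma (R n) (L n) in
  let loglik (w : T) (b : K) : K :=
    ln (likelihood sigma (R n) (L n)
          (sign_agree (R n) (L n) X Y xi xi' w) b) in
  let obs_info (w : T) : K := - ((loglik w)^`(2))%classic bstar in
  let info : K :=
    (p^`())%classic bstar ^+ 2 * ((p bstar)^-1 + (1 - p bstar)^-1) in
  [/\ 0 < p bstar < 1,
      (\forall b \near bstar, derivable p b 1) /\
        derivable (p^`())%classic bstar 1,
      ((n%:R^-1)%:E * 'E_P[obs_info] = info%:E)%E &
      info <= ((L n)%:num ^+ 2 * (R n)%:num ^+ 2)^-1 * C].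
Proof.
set s := 2 * (sigma ^+ 2 + bstar ^+ 2).
have s_gt0 : 0 < s.
  by rewrite mulr_gt0// ltr_wpDr ?sqr_ge0// exprn_gt0.
(* The assumed lower bound on L at n = 3, the smallest over n >= 3. *)
pose l0 := Num.sqrt (s * (ln (ln 3) `^ 2^-1)).
have l0_gt0 : 0 < l0.
  by rewrite sqrtr_gt0 mulr_gt0// powR_gt0// ln_gt0// ln3_gt1.
have bounds b := agree_prob_bounds sigma_gt0 b l0_gt0.
have [delta delta_gt0 delta_bound] := bounds bstar.
pose M := fine (\int[std_normal K]_x (x ^+ 2)%:E)%E.
(* From |p'| <= M / (2 L R) and both reciprocals at most 1/delta: M^2 / (4 L^2 R^2) times 2/delta.
   [M] and [delta] are fixed before [R] and [L]. *)
exists (M ^+ 2 / (2 * delta)) => R L hL _ n n3 d T P X Y xi xi' sample.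
have l0L : l0 <= (L n)%:num.
  by apply: le_trans (hL n n3); apply: dither_range_ge => //; exact: ltW.
move: (R n) (L n) l0L sample => {hL R L} r l l0l sample p loglik obs_info info.
(* Differentiating the log-likelihood calls for this at every [b]; the constant [e] may vary with
   [b]. *)
have p01 b : 0 < p b < 1.
  have [e e0 /(_ r l l0l) /andP[h1 h2]] := bounds b.
  by rewrite (lt_le_trans e0 h1)/= (le_lt_trans h2)// gtrBl.
have dp b : derivable p b 1 by exact: derivable_agree_prob.
have ddp : derivable (p^`())%classic bstar 1 by exact: derivable_derive1_agree_prob.
have /andP[p_gt0 p_lt1] := p01 bstar.
split => //.
- by split; [exists 1 => //= b _; exact: dp|exact: ddp].
- have -> : obs_info = fun w => \sum_(i < n) (if sign_agree r l X Y xi xi' w i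
      then - (((p^`())^`())%classic bstar / p bstar
              - (p^`()%classic bstar / p bstar) ^+ 2)
      else - (- ((p^`())^`())%classic bstar / (1 - p bstar)
              - (p^`()%classic bstar / (1 - p bstar)) ^+ 2)).
    apply/funext => w; rewrite /obs_info /loglik.
    rewrite (derive2_loglik (sign_agree r l X Y xi xi' w) p01 dp ddp) -sumrN.
    by apply: eq_bigr => i _; case: ifP.
  (* Weighted by p and 1 - p, the terms in p'' cancel and the squares leave p'^2 (1/p + 1/(1 -
     p)). *)
  rewrite (expectation_sum_if _ _ (measurable_sign_agree r l X Y xi xi')
    (sample_sign_agree sample)).
  rewrite -EFinM -/p /info; congr EFin; field.
  by rewrite (gt_eqF p_gt0) pnatr_eq0 -lt0n (ltn_trans _ n3)//= gt_eqF// subr_gt0.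
have /andP[pd1 pd2] := delta_bound r l l0l; rewrite -/p in pd1 pd2.
have inv_le x : delta <= x -> x^-1 <= delta^-1.
  by move=> h; rewrite lef_pV2 ?posrE// (lt_le_trans delta_gt0).
have r0 : 0 < r%:num by [].
have l_gt0 : 0 < l%:num by [].
rewrite /info; apply: (@le_trans _ _
  ((M / (2 * l%:num * r%:num)) ^+ 2 * (delta^-1 + delta^-1))).
  apply: ler_pM; rewrite ?sqr_ge0//.
  - by rewrite addr_ge0// invr_ge0 ltW// subr_gt0.
  - rewrite -[leLHS]real_normK ?num_real// ler_sqr ?nnegrE//.
      exact: derive1_agree_prob_le.
    rewrite divr_ge0 ?mulr_ge0// fine_ge0// integral_ge0// => x _.
    by rewrite lee_fin sqr_ge0.
  - by rewrite lerD// inv_le//; lra.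
by rewrite le_eqVlt; apply/orP; left; apply/eqP; field; rewrite !gt_eqF.
Qed.
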